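(* Every countable metric space which is indivisible is restricted, and hence totally Cantor disconnected.
   Context: A metric space $\mathbb{M}=(M;d)$ is divisible if there is a partition of $M$ into two parts, neither of which contains an isometric copy of $\mathbb{M}$; otherwise it is indivisible. For $\epsilon>0$, an $\epsilon$-chain joining $a_0$ and $a_n$ is a finite sequence $a_0,a_1,\dots,a_n$ of elements of $M$ with $d(a_i,a_{i+1})\leq\epsilon$ for all $i<n$. A metric space is Cantor connected if any two of its elements can be joined by an $\epsilon$-chain (in the space) for every $\epsilon>0$. The Cantor connected component of $a\in M$ is the largest Cantor connected subset of $M$ containing $a$. The space is totally Cantor disconnected if the Cantor connected component of every $a\in M$ is $\{a\}$. For $a\in M$ let $\lambda_\epsilon(a)$ be the supremum of all reals $l\leq 1$ for which there exists an $\epsilon$-chain $a_0,a_1,\dots,a_n$ containing $a$ with $d(a_0,a_n)\geq l$. Let $\lambda(a):=\sup\{l\in\mathbb{R} : \forall \epsilon>0\ (\lambda_\epsilon(a)\geq l)\}$. The space $(M;d)$ is restricted if $\lambda(a)=0$ for all $a\in M$. *)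

(* Defs.v *)
From HB Require Import structures.
From mathcomp Require Import all_boot all_order all_algebra.
From mathcomp Require Import all_classical all_reals all_analysis.

Set Implicit Arguments.
Unset Strict Implicit.
Unset Printing Implicit Defensive.

Import Order.TTheory GRing.Theory Num.Theory.
Local Open Scope classical_set_scope.
Local Open Scope ring_scope.

Section MetricNotions.
Context {R : realType} (M : metricType R).
Implicit Types (A B C : set M) (a x y : M) (s : seq M) (e l : R).

Definition contains_copy A :=
  exists2 f : M -> M,
    (forall x y, mdist (f x) (f y) = mdist x y) & range f `<=` A.

Definition divisible :=
  exists A B, [/\ A `|` B = setT, A `&` B = set0,
    ~ contains_copy A & ~ contains_copy B].

Definition indivisible := ~ divisible.

(* The sequence a_0, a_1, ..., a_n is represented by a_0 and
   s = [:: a_1; ...; a_n], so that a_n = last a_0 s; n = 0 is allowed. *)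
Definition eps_chain e a0 s := path (fun x y => mdist x y <= e) a0 s.

(* The chains joining two points of A are required to stay inside A, that is,
   A is Cantor connected as a metric space in its own right. *)
Definition cantor_connected A :=
  forall x y, A x -> A y -> forall e, 0 < e ->
    exists s, [/\ eps_chain e x s, last x s = y & [set` x :: s] `<=` A].

Definition is_cantor_component a C :=
  [/\ cantor_connected C, C a &
      forall A, cantor_connected A -> A a -> A `<=` C].

Definition totally_cantor_disconnected :=
  forall a, is_cantor_component a [set a].

Definition lambda_eps_set e a : set R :=
  [set l | l <= 1 /\ exists a0 s,
     [/\ eps_chain e a0 s, a \in a0 :: s & l <= mdist a0 (last a0 s)]].

Definition lambda_eps e a : R := sup (lambda_eps_set e a).

Definition lambda_set a : set R :=
  [set l | forall e, 0 < e -> l <= lambda_eps e a].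

Definition lambda a : R := sup (lambda_set a).

Definition restricted := forall a, lambda a = 0.

(* [sup] takes a default value on sets that are empty or unbounded above;
   the next two facts show that this never happens above. *)
Lemma has_sup_lambda_eps_set e a : has_sup (lambda_eps_set e a).
Proof.
split; last by exists 1 => l [].
exists 0; split; first exact: ler01.
by exists a, [::]; rewrite /= mdistxx inE eqxx.
Qed.

Lemma has_sup_lambda_set a : has_sup (lambda_set a).
Proof.
split.
  exists 0 => e _; apply: ub_le_sup; first by case: (has_sup_lambda_eps_set e a).
  split; first exact: ler01.
  by exists a, [::]; rewrite /= mdistxx inE eqxx.
exists 1 => l /(_ 1 ltr01) /le_trans; apply.
by apply: ge_sup; [case: (has_sup_lambda_eps_set 1 a)|move=> ? []].
Qed.

End MetricNotions.

(* Main.v *)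
Require Import Defs.
From mathcomp Require Import all_boot all_order all_algebra.
From mathcomp Require Import all_classical all_reals all_analysis.
From mathcomp Require Import lra zify.

(** For every [r > 0], a countable metric space has a 2-colouring in which each
    point [x] admits a step [e > 0], depending on [x], such that the
    monochromatic [e]-chains through [x] have their ends at distance less than
    [r] ([fragmenting_exists]).  It is essential that [e] may depend on [x]:
    with a uniform [e] this already fails in the rational plane, by the
    argument of the game of Hex.

    To obtain the colouring, cover the space by pairwise disjoint open balls of
    radius at most [r / 2] ([packing_cover]).  The balls are chosen one at a
    time along an enumeration of the space.  As the space is countable, the
    radii can avoid all distances from the centres, so a point outside the
    finitely many balls chosen so far is at positive distance from each of
    them and has room for a ball of its own.  Then cut each ball into
    concentric annuli which become thinner and accumulate only at its boundary,
    and colour them alternately.  A point of a ball of the cover lies strictly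
    inside it, so its annulus has two neighbours (or is the central disc) and
    both have positive width: a monochromatic chain with steps smaller than
    these widths stays in the annulus, and in particular cannot pass into
    another ball.

    If [lambda a > 0], there is [l > 0] such that for every [e > 0] some
    [e]-chain through [a] has its ends at distance at least [l]
    ([long_chains]).  An isometric copy of the space inside one colour class
    of the colouring for [r = l] would carry these chains to monochromatic
    chains through the image of [a], which is impossible.  Hence both classes
    are free of copies and the space is divisible.

    Finally, a Cantor connected set with two points [a <> b] contains chains
    from [a] to [b] of arbitrarily small step, so that
    [lambda a >= min 1 (mdist a b) > 0]; a restricted space has no such set. *)

Local Open Scope classical_set_scope.

Section Fragmentation.
#[local] Set Implicit Arguments.
#[local] Unset Strict Implicit.
#[local] Unset Printing Implicit Defensive.
Import Order.TTheory GRing.Theory Num.Theory.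
Local Open Scope ring_scope.

(** * Disjoint covers by small balls *)

(** A nonempty open interval has positive Lebesgue measure, a countable set has
    measure zero. *)
Lemma countable_avoid (R : realType) (D : set R) (s : R) :
  countable D -> 0 < s -> exists2 t, 0 < t < s & ~ D t.
Proof.
move=> cD s0; apply/not_exists2P => noavoid.
have sD : `]0, s[ `<=` D.
  by move=> t /=; rewrite in_itv /= => ts; have [|/contrapT] := noavoid t.
have : lebesgue_measure `]0%R, s[ = 0%E.
  apply: countable_lebesgue_measure0.
  exact: sub_countable (subset_card_le sD) cD.
rewrite lebesgue_measure_itv /= lte_fin s0 sube0 => -[] s_eq0.
by rewrite s_eq0 ltxx in s0.
Qed.

Lemma seq_pos_lbound (R : realType) (T : eqType) (L : seq T) (g : T -> R) :
  (forall p, p \in L -> 0 < g p) ->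
  exists2 s, 0 < s & forall p, p \in L -> s <= g p.
Proof.
elim: L => [|p L IH] gL; first by exists 1.
have [|s s0 sL] := IH; first by move=> q qL; apply: gL; rewrite inE qL orbT.
exists (Num.min s (g p)); first by rewrite lt_min s0 gL ?mem_head.
by move=> q; rewrite inE ge_min => /predU1P[->|/sL ->//]; rewrite lexx orbT.
Qed.

Context {R : realType} {M : metricType R}.
Implicit Types (p q : M * R) (x y z : M) (F : set (M * R)) (L : seq (M * R)).

Definition disc p : set M := [set x | mdist p.1 x < p.2].

(** The middle condition, that no point lies on the sphere bounding a ball of
    the family, makes the balls closed: a point outside a ball is at positive
    distance from it. *)
Record packing (r : R) F : Prop := Packing {
  packing_radius : forall p, F p -> p.2 <= r;
  packing_sphere : forall p x, F p -> mdist p.1 x != p.2;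
  packing_disjoint : forall p q x, F p -> F q -> disc p x -> disc q x -> p = q
}.

(** The family is a finite list so that the distances from an uncovered point to
    its balls have a positive lower bound. *)
Lemma packing_extend (r : R) L x : countable [set: M] -> 0 < r ->
  packing r [set` L] ->
  exists L', [/\ packing r [set` L'], {subset L <= L'} &
                 exists2 p, p \in L' & disc p x].
Proof.
move=> cM r0 pL.
have [xL|xL] := pselect (exists2 p, p \in L & disc p x).
  by exists L; split=> //.
have gap p : p \in L -> 0 < mdist p.1 x - p.2.
  move=> Lp; rewrite subr_gt0 lt_neqAle eq_sym (packing_sphere pL) //=.
  by rewrite leNgt; apply/negP => px; apply: xL; exists p.
have [s s0 sL] := seq_pos_lbound gap.
have [||t] := @countable_avoid _ (range (mdist x)) (Num.min s r).
- exact: sub_countable (card_image_le _ _) cM.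
- by rewrite lt_min s0.
rewrite lt_min => /and3P[t0 ts tr] tD.
have disj p y : p \in L -> disc p y -> disc (x, t) y -> False.
  rewrite /disc /= => /sL sp py ty.
  have := metric_triangle p.1 y x; rewrite (metric_sym y x); lra.
exists ((x, t) :: L); split.
- split=> [p|p y|p q y] /=; rewrite ?inE.
  + by move=> /predU1P[->|/(packing_radius pL)//]; rewrite ltW.
  + move=> /predU1P[->/=|/(packing_sphere pL)//].
    by apply/eqP => ty; apply: tD; exists y.
  + move=> /predU1P[->|Lp] /predU1P[->|Lq] py qy //.
    * by case: (disj q y).
    * by case: (disj p y).
    * exact: (packing_disjoint pL) Lp Lq py qy.
- by move=> p pL'; rewrite inE pL' orbT.
- by exists (x, t); rewrite ?mem_head // /disc /= mdistxx.
Qed.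

Lemma packing_cover (r : R) : countable [set: M] -> 0 < r ->
  exists2 F, packing r F & forall x, exists2 p, F p & disc p x.
Proof.
move=> cM r0; have /countable_injP[i /in2TT i_inj] := cM.
pose stage := {L : seq (M * R) | packing r [set` L]}.
have step (Ln : stage * nat) : exists L' : stage,
    {subset sval Ln.1 <= sval L'} /\
    forall x, i x = Ln.2 -> exists2 p, p \in sval L' & disc p x.
  case: Ln => -[L pL] n /=.
  have [[x ixn]|noi] := pselect (exists x, i x = n); last first.
    by exists (exist _ L pL); split=> // x ixn; case: noi; exists x.
  have [L' [pL' sL' L'x]] := @packing_extend r L x cM r0 pL.
  exists (exist _ L' pL'); split=> // y iyn.
  by have -> : y = x by apply: i_inj; rewrite ixn.
have [next nextP] := choice step.
have pack0 : packing r [set` [::]] by split=> // p x; rewrite inE.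
pose st := fix st n : stage :=
  if n is m.+1 then next (st m, m) else exist _ [::] pack0.
have st_mono m n : (m <= n)%N -> {subset sval (st m) <= sval (st n)}.
  move=> /subnK <-; elim: (n - m)%N => // k IH p /IH.
  by rewrite addSn /=; apply: (nextP (st (k + m)%N, _)).1.
exists [set p | exists n, p \in sval (st n)]; last first.
  move=> x; have [p pL px] := (nextP (st (i x), i x)).2 x erefl.
  by exists p => //; exists (i x).+1.
split=> [p [n]|p x [n]|p q x [m pm] [n qn]].
- exact: (packing_radius (svalP (st n))).
- exact: (packing_sphere (svalP (st n))).
apply: (packing_disjoint (svalP (st (maxn m n)))).
- exact: st_mono (leq_maxl _ _) _ pm.
- exact: st_mono (leq_maxr _ _) _ qn.
Qed.

(** * Alternating annuli *)

(** The [n]-th annulus of the ball of centre [c] and radius [u] is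
    [u (1 - 1/n) <= mdist c x < u (1 - 1/n.+1)], for [n >= 1]. *)
Definition annulus p x : nat := Num.truncn (p.2 / (p.2 - mdist p.1 x)).

Lemma annulus_itv p x : disc p x ->
  [/\ (0 < annulus p x)%N, (p.2 - mdist p.1 x) * (annulus p x)%:R <= p.2 &
      p.2 < (p.2 - mdist p.1 x) * (annulus p x).+1%:R].
Proof.
rewrite /disc /= => px; have d0 := mdist_ge0 p.1 x.
have w0 : 0 < p.2 - mdist p.1 x by rewrite subr_gt0.
have p0 : 0 < p.2 by exact: le_lt_trans px.
have /andP[lo hi] : _ <= _ < _ := truncn_itv (ltW (divr_gt0 p0 w0)).
rewrite truncn_gt0 ler_pdivlMr // mul1r; split; first lra.
- by rewrite mulrC -ler_pdivlMr.
- by rewrite mulrC -ltr_pdivrMr.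
Qed.

(** The width of the [n.+1]-st annulus, which is less than that of the
    [n.-1]-st one since the widths decrease. *)
Definition annulus_gap p (n : nat) : R := p.2 / (n.+1%:R * n.+2%:R).

(** A step no longer than the width of the next annulus, which is the thinner of
    the two neighbours, cannot jump over a neighbour. *)
Lemma annulus_step p y z : disc p y ->
    mdist y z <= annulus_gap p (annulus p y) ->
  disc p z /\ ((annulus p y).-1 <= annulus p z <= (annulus p y).+1)%N.
Proof.
move=> py; have [n0 lo hi] := annulus_itv py; have d0 := mdist_ge0 p.1 y.
rewrite /annulus_gap; case: (annulus p y) n0 lo hi => // n _ lo hi yz.
set e := _ / _ in yz.
(* The annulus of [y] has index [n.+1], that is [k + 1] in [R]. *)
rewrite -[n.+1]addn1 natrD in lo; rewrite -[n.+2]addn2 natrD in hi.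
have dz1 := metric_triangle p.1 y z; have dz2 := metric_triangle p.1 z y.
rewrite (metric_sym z y) in dz2.
set k : R := n%:R in lo hi; set u := p.2 in lo hi.
set dy := mdist p.1 y in lo hi d0 dz1 dz2.
have k0 : 0 <= k by [].
have e_def : e * ((k + 2) * (k + 3)) = u.
  by rewrite /e -[n.+3]addn3 -[n.+2]addn2 !natrD divfK //.
have u0 : 0 < u by apply: le_lt_trans py; exact: d0.
have e0 : 0 < e.
  rewrite -(pmulr_lgt0 _ (_ : 0 < (k + 2) * (k + 3))) ?e_def //.
  by apply: mulr_gt0; lra.
have outer : u < (u - mdist p.1 z) * (k + 3).
  rewrite -(ltr_pM2r (_ : 0 < k + 2)); last lra.
  have : 0 < ((u - dy) * (k + 2) - u) * (k + 3) by apply: mulr_gt0; lra.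
  have : 0 <= (dy + e - mdist p.1 z) * ((k + 2) * (k + 3)).
    by apply: mulr_ge0; [lra|apply: mulr_ge0; lra].
  lra.
have inner : (u - mdist p.1 z) * k <= u.
  rewrite -(ler_pM2r (_ : 0 < k + 1)); last lra.
  have : 0 <= (u - (u - dy) * (k + 1)) * k by apply: mulr_ge0; lra.
  have : 0 <= (mdist p.1 z + e - dy) * (k * (k + 1)).
    by apply: mulr_ge0; [lra|apply: mulr_ge0; lra].
  have : 0 <= e * (4 * k + 6) by apply: mulr_ge0; lra.
  lra.
have pz : disc p z.
  rewrite /disc /= -subr_gt0 -(pmulr_lgt0 _ (_ : 0 < k + 3)); last lra.
  exact: lt_trans outer.
have [_ lo' hi'] := annulus_itv pz; split => //.
have wz : 0 < u - mdist p.1 z by rewrite subr_gt0.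
apply/andP; split.
  rewrite /= -ltnS -(ltr_nat R) -(ltr_pM2l wz); exact: le_lt_trans inner hi'.
rewrite -ltnS -(ltr_nat R) -(ltr_pM2l wz).
apply: le_lt_trans lo' _; apply: lt_le_trans outer _.
by rewrite -[n.+3]addn3 natrD.
Qed.

(** * The colouring *)

(** The set [P] plays the part of the monochromatic [e]-component of [x]: a set
    that contains this component and still has small diameter. *)
Definition fragmenting (r : R) (col : M -> bool) :=
  forall x, exists e (P : set M),
  [/\ 0 < e, P x, forall y z, P y -> P z -> mdist y z < r &
      forall y z, col y = col z -> mdist y z <= e -> P y -> P z].

Lemma fragmenting_exists (r : R) : countable [set: M] -> 0 < r ->
  exists col, fragmenting r col.
Proof.
move=> cM r0; have r20 : 0 < r / 2 by lra.
have [F pF coverF] := packing_cover cM r20.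
have [cell cellP] : exists cell, forall x, F (cell x) /\ disc (cell x) x.
  have /choice[cell] x : exists p, F p /\ disc p x; last by exists cell.
  by have [p] := coverF x; exists p.
exists (fun x => odd (annulus (cell x) x)) => x.
have [Fp px] := cellP x; set p := cell x in Fp px *.
have cellE y : disc p y -> cell y = p.
  move=> py; have [Fq qy] := cellP y.
  exact: (packing_disjoint pF) Fq Fp qy py.
exists (annulus_gap p (annulus p x)).
exists [set y | disc p y /\ annulus p y = annulus p x]; split=> //.
- rewrite divr_gt0 ?mulr_gt0 //; exact: le_lt_trans (mdist_ge0 _ _) px.
- move=> y z [py _] [pz _]; have := packing_radius pF Fp.
  have := metric_triangle y p.1 z; rewrite (metric_sym y p.1).
  move: py pz; rewrite /disc /=; lra.
(* The indices of the annuli of [y] and [z] differ by at most one and have the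
   same parity. *)
- move=> y z col_yz yz [py ny]; rewrite -ny in yz *.
  have [pz /andP[n1 n2]] := annulus_step py yz; split=> //.
  move: col_yz; rewrite !cellE // => col_yz.
  have [n0 _ _] := annulus_itv py; lia.
Qed.

(** * Chains in copies of the space *)

Lemma path_closed (T : eqType) (e : rel T) (P : T -> Prop) (a0 a : T) s :
  (forall u v, e u v -> P u <-> P v) -> path e a0 s -> a \in a0 :: s -> P a ->
  P a0 /\ P (last a0 s).
Proof.
move=> eP; elim: s a0 a => [|b s IH] a0 a /=; first by rewrite inE => _ /eqP->.
move=> /andP[/eP ab bs]; rewrite inE => /predU1P[-> Pa|a_bs Pa].
  by split=> //; have [_] := IH b b bs (mem_head _ _) (ab.1 Pa).
by have [/ab] := IH b a bs a_bs Pa.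
Qed.

(** The isometry [f] carries a chain through [a] to a monochromatic chain through
    [f a] with the same steps and the same distance between its ends; the step
    [e] is the one that the colouring provides at [f a]. *)
Lemma copy_chain_short (r : R) col (f : M -> M) (a : M) :
    fragmenting r col -> (forall x y : M, mdist (f x) (f y) = mdist x y) ->
    (forall x y : M, col (f x) = col (f y)) ->
  exists2 e, 0 < e & forall (a0 : M) s, eps_chain e a0 s -> a \in a0 :: s ->
    mdist a0 (last a0 s) < r.
Proof.
move=> frag f_iso f_mono; have [e [P [e0 Pa Pr Pe]]] := frag (f a).
exists e => // a0 s chain a_s; rewrite -f_iso.
have [|P0 Pl] := path_closed (P := P \o f) _ chain a_s Pa; last exact: Pr.
by move=> y z yz; split; apply: Pe; rewrite // f_iso // metric_sym.
Qed.

Lemma lambda_ge0 (a : M) : 0 <= lambda a.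
Proof.
apply: ub_le_sup; first by case: (has_sup_lambda_set a).
move=> e _; apply: ub_le_sup; first by case: (has_sup_lambda_eps_set e a).
by split; [exact: ler01|exists a, [::]; rewrite /= mdistxx inE eqxx].
Qed.

Lemma long_chains (a : M) : 0 < lambda a -> exists2 l, 0 < l &
  forall e, 0 < e -> exists a0 s,
    [/\ eps_chain e a0 s, a \in a0 :: s & l <= mdist a0 (last a0 s)].
Proof.
move=> la0; have [l al l0] := sup_gt (has_sup_lambda_set a).1 la0.
(* [l] is only a lower bound of suprema that need not be attained; [l / 2] is
   exceeded by an actual chain. *)
exists (l / 2) => [|e e0]; first by rewrite divr_gt0.
have [|l' [_ [a0 [s [chain a_s l's]]]] ll'] :=
    @sup_gt _ _ (l / 2) (has_sup_lambda_eps_set e a).1.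
  by apply: lt_le_trans (al e e0); lra.
by exists a0, s; split=> //; apply: le_trans l's; exact: ltW.
Qed.

Lemma indivisible_restricted :
  countable [set: M] -> indivisible M -> restricted M.
Proof.
move=> cM indM a; apply/eqP; rewrite eq_le lambda_ge0 andbT leNgt.
apply/negP => /long_chains[l l0 chains]; apply: indM.
have [col frag] := fragmenting_exists cM l0.
have no_copy b : ~ contains_copy [set x | col x = b].
  move=> [f f_iso fb].
  have [|e e0 short] := copy_chain_short a frag f_iso.
    by move=> x y; rewrite [col (f x)]fb 1?[col (f y)]fb; [|exists y|exists x].
  have [a0 [s [chain a_s]]] := chains e e0.
  by rewrite leNgt (short a0 s).
exists [set x | col x = true], [set x | col x = false]; split=> //.
- by apply/seteqP; split=> x //= _; case: (col x); [left|right].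
- by apply/seteqP; split=> x //= [->].
Qed.

Lemma restricted_totally_disconnected :
  restricted M -> totally_cantor_disconnected M.
Proof.
move=> restM a; split=> //.
  move=> x y -> -> e e0; exists [::]; split=> // z.
  by rewrite /= inE => /eqP.
move=> A A_conn Aa b Ab; apply: contrapT => /eqP ba.
pose l := Num.min 1 (mdist a b).
have l0 : 0 < l by rewrite lt_min ltr01 mdist_gt0 eq_sym.
have : l <= lambda a.
  apply: ub_le_sup; first by case: (has_sup_lambda_set a).
  move=> e e0; apply: ub_le_sup; first by case: (has_sup_lambda_eps_set e a).
  have [s [chain sb _]] := A_conn a b Aa Ab e e0.
  split; first by rewrite ge_min lexx.
  by exists a, s; split; rewrite ?mem_head // sb ge_min lexx orbT.
by rewrite restM leNgt l0.
Qed.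

End Fragmentation.

Theorem corollary3p5 (R : realType) (M : metricType R)
    (countableM : countable [set: M]) (indivisibleM : indivisible M) :
  restricted M /\ totally_cantor_disconnected M.
Proof.
have restM := indivisible_restricted countableM indivisibleM.
split=> //; exact: restricted_totally_disconnected.
Qed.
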